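(* Let $\mathcal{H}$ be a complex Hilbert space and let $T\in\mathcal{B}(\mathcal{H})$ be a $\Delta_T$-regular completely hyperexpansive operator. For $n\ge1$ let $A_n(T)=-\sum_{j=0}^n(-1)^j\binom{n}{j}T^{*j}T^j\ (\ge0)$. The following statements are equivalent: (i) $T$ is $A_n(T)$-regular for every integer $n\ge2$; (ii) $T$ is $A_j(T)$-regular for $j=2,3$; (iii) $T$ is $A_2(T)$-regular and the compression $P_{\overline{A_2(T)\mathcal{H}}}T|_{\overline{A_2(T)\mathcal{H}}}$ of $T$ to $\overline{A_2(T)\mathcal{H}}$ is a quasinormal contraction. In addition, if one of (i)–(iii) holds, then $\mathcal{N}(A_2(T))=\mathcal{N}(A_n(T))$ for all $n\ge3$.
   Context: $\Delta_T=T^*T-I$ (so $A_1(T)=\Delta_T$). $T$ is completely hyperexpansive if $\sum_{j=0}^n(-1)^j\binom{n}{j}T^{*j}T^j\le0$ for all $n\ge1$. For a positive operator $A$, $T$ is $A$-regular if $AT=A^{1/2}TA^{1/2}$. An operator $Q$ is quasinormal if $QQ^*Q=Q^*Q^2$. *)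

(* Defs.v *)
(* Complex Hilbert spaces and bounded operators, set up
   from first principles.
   Scalars: C := R[i] for R : realType (i.e. the complex numbers).
   In C, the order is the usual partial order of numClosedFieldType:
   0 <= z  iff  z is a nonnegative real. *)
From mathcomp Require Import all_boot all_algebra.
From mathcomp Require Import complex reals.
Set Implicit Arguments. Unset Strict Implicit. Unset Printing Implicit Defensive.
Import GRing.Theory Num.Theory.
Local Open Scope ring_scope.

Section Hilbert.
Variables (R : realType) (H : lmodType R[i]) (ip : H -> H -> R[i]).

(* ip is an inner product (linear in the first variable, conjugate-symmetric,
   positive definite) and H is complete for the induced norm ||x||^2 = ip x x. *)
Definition inner_product : Prop :=
  [/\ (forall (a : R[i]) (x y z : H), ip (a *: x + y) z = a * ip x z + ip y z),
      (forall x y : H, ip y x = (ip x y)^*),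
      (forall x : H, 0 <= ip x x) &
      (forall x : H, ip x x = 0 -> x = 0)].

Definition cauchy_seq (u : nat -> H) : Prop :=
  forall e : R[i], 0 < e -> exists N : nat, forall m n : nat, (N <= m)%N -> (N <= n)%N ->
    ip (u m - u n) (u m - u n) < e.

Definition converges_to (u : nat -> H) (l : H) : Prop :=
  forall e : R[i], 0 < e -> exists N : nat, forall n : nat, (N <= n)%N ->
    ip (u n - l) (u n - l) < e.

Definition hilbert_space : Prop :=
  inner_product /\ forall u : nat -> H, cauchy_seq u -> exists l : H, converges_to u l.

(* bounded linear operator, T in B(H) *)
Definition bounded_op (T : H -> H) : Prop :=
  linear T /\ exists c : R[i], 0 <= c /\ forall x : H, ip (T x) (T x) <= c * ip x x.

(* S is the Hilbert-space adjoint of T *)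
Definition is_adjoint (T S : H -> H) : Prop :=
  forall x y : H, ip (T x) y = ip x (S y).

(* positive (bounded) operator *)
Definition positive_op (A : H -> H) : Prop :=
  bounded_op A /\ forall x : H, 0 <= ip (A x) x.

(* T is A-regular: A T = A^{1/2} T A^{1/2}, where A^{1/2} is THE positive square
   root of A (unique, so it is referred to as any positive S with S S = A). *)
Definition regular (A T : H -> H) : Prop :=
  forall S : H -> H, positive_op S -> (forall x, S (S x) = A x) ->
    forall x : H, A (T x) = S (T (S x)).

(* sum_{j=0}^n (-1)^j C(n,j) T*^j T^j, applied to x *)
Definition altsum (T Ts : H -> H) (n : nat) (x : H) : H :=
  \sum_(j < n.+1) (((-1) ^+ j * ('C(n, j))%:R) *: iter j Ts (iter j T x)).

(* A_n(T) = - sum_{j=0}^n (-1)^j C(n,j) T*^j T^j *)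
Definition A_op (T Ts : H -> H) (n : nat) (x : H) : H := - altsum T Ts n x.

(* Delta_T = T* T - I *)
Definition Delta (T Ts : H -> H) (x : H) : H := Ts (T x) - x.

(* completely hyperexpansive: sum_{j=0}^n (-1)^j C(n,j) T*^j T^j <= 0 for all n >= 1 *)
Definition comp_hyperexpansive (T Ts : H -> H) : Prop :=
  forall n : nat, (1 <= n)%N -> forall x : H, ip (altsum T Ts n x) x <= 0.

(* norm closure of a set *)
Definition closure_ip (M : H -> Prop) (x : H) : Prop :=
  forall e : R[i], 0 < e -> exists m : H, M m /\ ip (x - m) (x - m) < e.

Definition range (A : H -> H) (y : H) : Prop := exists x : H, y = A x.

(* P is the orthogonal projection onto M *)
Definition is_orth_proj (M : H -> Prop) (P : H -> H) : Prop :=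
  forall x : H, M (P x) /\ forall y : H, M y -> ip (x - P x) y = 0.

(* C (mapping M into M) is, as an operator on the closed subspace M, a
   quasinormal contraction: ||Cx|| <= ||x|| on M, and C C* C = C* C C on M,
   where C* is the adjoint of C in the Hilbert space M. *)
Definition quasinormal_contraction_on (M : H -> Prop) (C : H -> H) : Prop :=
  (forall x : H, M x -> ip (C x) (C x) <= ip x x) /\
  forall Cs : H -> H, (forall x, M x -> M (Cs x)) ->
    (forall x y : H, M x -> M y -> ip (C x) y = ip x (Cs y)) ->
    forall x : H, M x -> C (Cs (C x)) = Cs (C (C x)).

End Hilbert.

(* Main.v *)
(** For positive [A] bounded and [S = A^(1/2)], [A T = S T S] is equivalent to
    [A^2 T = A T A]: one direction is algebra, and conversely [A T] commutes with
    [A], hence with [S], so that [S^2 (T S - S T) = 0].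

    Write [A_(n+1) = A_n - T^* A_n T].  If [A_(n+2) x = 0] then [<A_(n+1) T^k x, T^k x>]
    does not depend on [k], while its partial sums are bounded by [<A_n x, x>]; hence
    all the kernels of [A_n], [n >= 2], coincide.

    Let [E = A_2], [P] the projection onto the closure of its range, [C = P T] and
    [Q = 1 - C^* C].  If [T] is [E]-regular then [E] commutes with [C] and [C^*], and
    [A_3 = E Q], which forces [C] to be a contraction.  If [T] is also [A_3]-regular
    then [A_3 (Q C - C Q) = 0], and since [A_3] and [E] have the same kernel, [C] is
    quasinormal.  Finally, if [C] is quasinormal then [A_(n+2) = Q^n E] commutes
    with [C], so that [T] is [A_n]-regular for all [n >= 2]. *)

From mathcomp Require Import all_boot all_order all_algebra.
From mathcomp Require Import complex.
From mathcomp Require Import boolp classical_sets reals topology normedtype sequences.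
From mathcomp Require Import ring lra.
Require Import Defs.
Set Implicit Arguments. Unset Strict Implicit. Unset Printing Implicit Defensive.
Import Order.TTheory GRing.Theory Num.Theory.
Import numFieldNormedType.Exports.
Local Open Scope ring_scope.
Local Open Scope complex_scope.

(** * Elementary rules for linear maps *)

Section Linear.
Variables (R : realType) (H : lmodType R[i]).
Implicit Types (A : H -> H) (x y : H).

Lemma linearPD A : linear A -> {morph A : x y / x + y}.
Proof. by move=> hA x y; rewrite -[x in LHS]scale1r hA scale1r. Qed.

Lemma linearP0 A : linear A -> A 0 = 0.
Proof. by move=> hA; apply: (addrI (A 0)); rewrite -linearPD // !addr0. Qed.

Lemma linearPZ A : linear A -> forall a, {morph A : x / a *: x}.
Proof. by move=> hA a x; rewrite -[a *: x]addr0 hA linearP0 // addr0. Qed.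

Lemma linearPN A : linear A -> {morph A : x / - x}.
Proof. by move=> hA x; rewrite -scaleN1r linearPZ // scaleN1r. Qed.

Lemma linearPB A : linear A -> {morph A : x y / x - y}.
Proof. by move=> hA x y; rewrite linearPD // linearPN. Qed.

End Linear.

(** * The real inner product *)

Section RealInnerProduct.
Variables (R : realType) (H : lmodType R[i]) (ip : H -> H -> R[i]).
Hypothesis hip : inner_product ip.
Implicit Types (A B C S T Z : H -> H) (x y z : H) (a b c e t : R).

(** The real part brings all estimates into the ordered field [R]; the imaginary part is recovered
    by inserting ['i], as in [dot_i]. *)
Definition dot x y : R := complex.Re (ip x y).

Lemma dotC x y : dot x y = dot y x.
Proof. by case: hip => _ hC _ _; rewrite /dot hC; case: (ip y x). Qed.

Lemma dotDl x y z : dot (x + y) z = dot x z + dot y z.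
Proof.
case: hip => hl _ _ _; rewrite /dot -[x in LHS]scale1r hl mul1r.
by case: (ip x z); case: (ip y z).
Qed.

Lemma dotDr x y z : dot x (y + z) = dot x y + dot x z.
Proof. by rewrite dotC dotDl !(dotC x). Qed.

Lemma ip0l y : ip 0 y = 0.
Proof.
case: hip => hl _ _ _; apply: (addrI (ip 0 y)).
by rewrite -[X in X + _]mul1r -hl scaler0 !addr0.
Qed.

Lemma ipZl (k : R[i]) x y : ip (k *: x) y = k * ip x y.
Proof. by case: hip => hl _ _ _; rewrite -[k *: x]addr0 hl ip0l addr0. Qed.

Lemma dotZl a x y : dot (a%:C *: x) y = a * dot x y.
Proof. by rewrite /dot ipZl; case: (ip x y) => u v /=; rewrite mul0r subr0. Qed.

Lemma dotZr a x y : dot x (a%:C *: y) = a * dot x y.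
Proof. by rewrite dotC dotZl dotC. Qed.

Lemma dotNl x y : dot (- x) y = - dot x y.
Proof.
have := dotZl (-1) x y; rewrite mulN1r => <-.
by rewrite rmorphN1 scaleN1r.
Qed.

Lemma dotNr x y : dot x (- y) = - dot x y.
Proof. by rewrite dotC dotNl dotC. Qed.

Lemma dot0l y : dot 0 y = 0.
Proof. by rewrite /dot ip0l. Qed.

Lemma dot0r y : dot y 0 = 0.
Proof. by rewrite dotC dot0l. Qed.

Definition dotE := (dotDl, dotDr, dotNl, dotNr, dotZl, dotZr).

Lemma ip_dot x : ip x x = (dot x x)%:C.
Proof.
case: hip => _ _ hp _; have := hp x; rewrite /dot lecE /=.
by case: (ip x x) => u v /= /andP[/eqP -> _].
Qed.

Lemma dot_ge0 x : 0 <= dot x x.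
Proof. by case: hip => _ _ hp _; have := hp x; rewrite ip_dot lecR. Qed.

Lemma dot_eq0 x : dot x x = 0 -> x = 0.
Proof. by case: hip => _ _ _ hd h; apply: hd; rewrite ip_dot h. Qed.

Lemma dot_ext x y : (forall z, dot x z = dot y z) -> x = y.
Proof.
move=> h; apply/eqP; rewrite -subr_eq0; apply/eqP/dot_eq0.
by rewrite dotDl dotNl h subrr.
Qed.

Lemma dot_i x y : dot ('i *: x) y = - complex.Im (ip x y).
Proof. by rewrite /dot ipZl; case: (ip x y) => u v /=; ring. Qed.

Lemma dot_ir x y : dot x ('i *: y) = complex.Im (ip x y).
Proof.
rewrite dotC dot_i; case: hip => _ hC _ _; rewrite (hC x y).
by case: (ip x y) => u v /=; rewrite opprK.
Qed.

(** Expand the square of [t x - y] and divide by [t]. This plays the part of Cauchy-Schwarz in the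
    approximation arguments. *)
Lemma young t x y : 0 < t -> 2 * dot x y <= t * dot x x + t^-1 * dot y y.
Proof.
move=> t0; have := dot_ge0 (t%:C *: x - y); rewrite !dotE (dotC y x).
move=> h; rewrite -(ler_pM2l t0) mulrDr [t * (t^-1 * _)]mulrA divff ?gt_eqF //.
by nra.
Qed.

(** * Positive operators *)

Definition dot_adjoint A B := forall x y, dot (A x) y = dot x (B y).

(** Symmetry is a clause of its own because nonnegativity of the real form does not imply it. *)
Definition psd A :=
  [/\ linear A, dot_adjoint A A & forall x, 0 <= dot (A x) x].

Lemma psd_lin A : psd A -> linear A. Proof. by case. Qed.

Lemma psd_sym A : psd A -> dot_adjoint A A. Proof. by case. Qed.

Lemma psd_ge0 A x : psd A -> 0 <= dot (A x) x. Proof. by case. Qed.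

Lemma is_adjoint_dot A B : is_adjoint ip A B -> dot_adjoint A B.
Proof. by move=> h x y; rewrite /dot h. Qed.

Lemma dot_adjoint_flip A B : dot_adjoint A B -> dot_adjoint B A.
Proof. by move=> h x y; rewrite dotC -h dotC. Qed.

Lemma dot_ii x y : dot ('i *: x) ('i *: y) = dot x y.
Proof. by rewrite dot_ir ipZl /dot; case: (ip x y) => u v /=; ring. Qed.

Lemma dot_adjoint_lin A B : linear A -> dot_adjoint A B -> linear B.
Proof.
move=> lA h; have hi y : B ('i *: y) = 'i *: B y.
  apply: dot_ext => z; rewrite dotC -h [RHS]dotC !dot_ir.
  have := h ('i *: z) y; rewrite linearPZ // !dot_i.
  by move/eqP; rewrite eqr_opp => /eqP.
have hD : {morph B : x y / x + y}.
  by move=> x y; apply: dot_ext => z; rewrite dotC -h dotDr dotDl !h !(dotC z).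
have hr a y : B (a%:C *: y) = a%:C *: B y.
  by apply: dot_ext => z; rewrite dotC -h dotZr h dotZl dotC.
move=> k x y; rewrite hD; congr (_ + _).
rewrite (complexE k) !scalerDl hD hr; congr (_ + _).
by rewrite -!scalerA hi hr.
Qed.

Lemma psd_ip_ge0 A x : psd A -> 0 <= ip (A x) x.
Proof.
case=> lA sA pA; rewrite lecE /= -/(dot (A x) x) pA andbT -dot_ir.
have e1 : dot (A x) ('i *: x) = complex.Im (ip x (A x)) by rewrite sA linearPZ // dot_ir.
have e2 : dot (A x) ('i *: x) = - complex.Im (ip x (A x)) by rewrite dotC dot_i.
by apply/eqP; lra.
Qed.

Lemma positive_op_psd A : positive_op ip A -> psd A.
Proof.
case=> -[lA _] pA.
have im0 x : complex.Im (ip (A x) x) = 0.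
  by have := pA x; rewrite lecE => /andP[/eqP].
split=> // [x y|x]; last by have := pA x; rewrite lecE => /andP[].
(* Polarization: the vanishing imaginary part at [x + i y] says that [Re <A x, y> = Re <A y, x>]. *)
have := im0 (x + 'i *: y); rewrite -dot_ir linearPD // linearPZ // scalerDr.
rewrite scalerA -expr2 sqr_i scaleN1r !dotDl !dotDr !dotNr dot_ii dot_ir dot_i !im0.
by rewrite (dotC x (A y)); lra.
Qed.

(** This is [A^2 <= A] for [0 <= A <= 1]: combine positivity at [x - A x] with the upper bound at
    [A x]. *)
Lemma psd_contraction A x : psd A -> (forall y, dot (A y) y <= dot y y) ->
  dot (A x) (A x) <= dot (A x) x.
Proof.
case=> lA sA pA hA; have := pA (x - A x); have := hA (A x).
by rewrite linearPB // !dotE (sA (A x) x); lra.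
Qed.

(** The form at [x - t A x] is a nonnegative quadratic in [t] without constant term, so its linear
    coefficient [-2 |A x|^2] vanishes. *)
Lemma psd_kernel A x : psd A -> dot (A x) x = 0 -> A x = 0.
Proof.
case=> lA sA pA hx; apply: dot_eq0.
set n := dot (A x) (A x); set m := dot (A (A x)) (A x).
have n0 : 0 <= n by exact: dot_ge0.
have m0 : 0 <= m by exact: pA.
have q t : 0 <= t * t * m - 2 * t * n.
  have := pA (x - t%:C *: A x); rewrite linearPB // linearPZ // !dotE hx.
  by rewrite (sA (A x) x) -/n -/m; lra.
apply/eqP; rewrite eq_le n0 andbT leNgt; apply/negP => n1.
(* The quadratic is negative at [t = n / (m + 1)]; the added 1 keeps the denominator positive when
   [m = 0]. *)
have m1 : 0 < m + 1 by lra.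
have := q (n / (m + 1)); have -> : n / (m + 1) * (n / (m + 1)) * m - 2 * (n / (m + 1)) * n
   = (n / (m + 1)) ^+ 2 * (m - 2 * (m + 1)) by field; rewrite gt_eqF.
have : 0 < (n / (m + 1)) ^+ 2 by rewrite exprn_gt0 // divr_gt0.
by nra.
Qed.

Lemma symmetric_sqr_kernel A x : dot_adjoint A A -> A (A x) = 0 -> A x = 0.
Proof. by move=> sA h; apply: dot_eq0; rewrite sA h dot0r. Qed.

Lemma dot_sym_ext A B : linear A -> linear B -> dot_adjoint A A -> dot_adjoint B B ->
  (forall x, dot (A x) x = dot (B x) x) -> A =1 B.
Proof.
move=> lA lB sA sB h x; apply: dot_ext => y.
have := h (x + y); rewrite !linearPD // !dotE !h (sA y x) (sB y x) !(dotC y).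
by lra.
Qed.

(** For [y = S x - S' x], commutation gives [(S + S') y = 0]. Both forms then vanish at [y], so
    [S y = S' y = 0] and [|y|^2 = <x, S y - S' y> = 0]. *)
Lemma psd_sqrt_unique S S' : psd S -> psd S' -> (forall x, S (S' x) = S' (S x)) ->
  (forall x, S (S x) = S' (S' x)) -> S =1 S'.
Proof.
move=> pS pS' hc hs x; pose y := S x - S' x.
have h0 : dot (S y) y + dot (S' y) y = 0.
  rewrite -dotDl [X in dot X _](_ : _ = 0) ?dot0l // /y.
  rewrite (linearPB (psd_lin pS)) (linearPB (psd_lin pS')) hc hs.
  by rewrite addrA subrK subrr.
have Sy : S y = 0.
  by apply: psd_kernel => //; have := psd_ge0 y pS; have := psd_ge0 y pS'; lra.
have Sy' : S' y = 0.
  by apply: psd_kernel => //; have := psd_ge0 y pS; have := psd_ge0 y pS'; lra.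
apply/eqP; rewrite -subr_eq0; apply/eqP/dot_eq0; rewrite -/y {1}/y.
by rewrite dotDl dotNl (psd_sym pS) (psd_sym pS') Sy Sy' !dot0r subrr.
Qed.

(** * Square roots *)

Lemma psd_eq A B : A =1 B -> psd A -> psd B.
Proof. by move=> /funext ->. Qed.

Lemma psd0 : psd (fun=> 0).
Proof.
split=> [k x y|x y|x]; first by rewrite scaler0 addr0.
  by rewrite dot0l dot0r.
by rewrite dot0l.
Qed.

Lemma psdD A B : psd A -> psd B -> psd (fun x => A x + B x).
Proof.
move=> pA pB; split=> [k x y|x y|x].
- by rewrite (psd_lin pA) (psd_lin pB) scalerDr addrACA.
- by rewrite !dotE (psd_sym pA) (psd_sym pB).
- by rewrite dotDl addr_ge0 ?psd_ge0.
Qed.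

Lemma psdZ a A : 0 <= a -> psd A -> psd (fun x => a%:C *: A x).
Proof.
move=> a0 pA; split=> [k x y|x y|x].
- by rewrite (psd_lin pA) scalerDr !scalerA (mulrC k).
- by rewrite !dotE (psd_sym pA).
- by rewrite dotZl mulr_ge0 ?psd_ge0.
Qed.

Lemma psd_iter A k : psd A -> psd (iter k A).
Proof.
move=> pA; split.
- elim: k => [|k IH] c x y //=; by rewrite IH (psd_lin pA).
- by elim: k => [|k IH] x y //; rewrite iterS iterSr (psd_sym pA) IH.
(* Descend by two: [<A^(k+2) x, x> = <A^k (A x), A x>]. *)
- elim/ltn_ind: k => -[|[|k]] IH x; [exact: dot_ge0|exact: psd_ge0|].
  by rewrite iterS iterSr (psd_sym pA) IH.
Qed.

(* Polynomials in [B] with nonnegative coefficients. *)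
Inductive cone B : (H -> H) -> Prop :=
| cone_iter k : cone B (iter k B)
| cone_add Z W : cone B Z -> cone B W -> cone B (fun x => Z x + W x)
| cone_scale a Z : 0 <= a -> cone B Z -> cone B (fun x => a%:C *: Z x).

Lemma cone_psd B Z : psd B -> cone B Z -> psd Z.
Proof.
move=> pB; elim=> [k|U W _ pU _ pW|a U a0 _ pU]; first exact: psd_iter.
  exact: psdD.
exact: psdZ.
Qed.

Lemma cone_lin B Z : linear B -> cone B Z -> linear Z.
Proof.
move=> lB; elim=> [k|U W _ lU _ lW|a U a0 _ lU] c x y.
- by elim: k => //= k ->; rewrite lB.
- by rewrite lU lW scalerDr addrACA.
- by rewrite lU scalerDr !scalerA (mulrC c).
Qed.

Lemma cone_comm B C Z : cone B Z -> linear C ->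
  (forall x, C (B x) = B (C x)) -> forall x, C (Z x) = Z (C x).
Proof.
move=> cZ lC hC; elim: cZ => [k|U W _ hU _ hW|a U a0 _ hU] x.
- by elim: k => //= k IH; rewrite hC IH.
- by rewrite linearPD // hU hW.
- by rewrite linearPZ // hU.
Qed.

Lemma cone_comp B Z W : linear B -> cone B Z -> cone B W -> cone B (fun x => Z (W x)).
Proof.
move=> lB cZ cW; elim: cZ => [k|U V _ hU _ hV|a U a0 _ hU].
- have lk : linear (iter k B) by exact: cone_lin (cone_iter B k).
  elim: cW => [j|U V _ hU _ hV|a U a0 _ hU].
  + rewrite (_ : (fun x => _) = iter (k + j) B); first exact: cone_iter.
    by apply/funext => x; rewrite iterD.
  + rewrite (_ : (fun x => _) = (fun x => iter k B (U x) + iter k B (V x))).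
      exact: cone_add.
    by apply/funext => x; rewrite linearPD.
  + rewrite (_ : (fun x => _) = (fun x => a%:C *: iter k B (U x))).
      exact: cone_scale.
    by apply/funext => x; rewrite linearPZ.
- exact: (cone_add hU hV).
- exact: (cone_scale a0 hU).
Qed.

(* If [0 <= B <= 1], these increase to [1 - sqrt (1 - B)], the solution of
   [Y = (B + Y^2) / 2]. *)
Fixpoint sqrt_approx B n : H -> H :=
  if n is m.+1 then fun x => (2^-1)%:C *: (B x + sqrt_approx B m (sqrt_approx B m x))
  else fun=> 0.

Lemma sqrt_approx_cone B n : linear B -> cone B (sqrt_approx B n).
Proof.
move=> lB; elim: n => [|n IH] /=.
  rewrite (_ : (fun=> 0) = (fun x => 0%:C *: iter 0 B x)); last first.
    by apply/funext => x; rewrite scale0r.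
  exact: cone_scale (cone_iter B 0).
apply: cone_scale; first by rewrite invr_ge0.
by apply: cone_add (cone_iter B 1) _; apply: cone_comp.
Qed.

(** The approximants commute, so [Y_(n+2) - Y_(n+1) = (Y_(n+1) + Y_n) (Y_(n+1) - Y_n) / 2].
    Membership in the cone, unlike [psd], visibly passes to products. *)
Lemma sqrt_approx_incr B n : linear B ->
  cone B (fun x => sqrt_approx B n.+1 x - sqrt_approx B n x).
Proof.
move=> lB; elim: n => [|n IH].
  rewrite (_ : (fun x => _) = (fun x => (2^-1)%:C *: iter 1 B x)).
    by apply: cone_scale (cone_iter B 1); rewrite invr_ge0.
  by apply/funext => x; rewrite /= addr0 subr0.
set Y := sqrt_approx B n.+1 in IH *; set X := sqrt_approx B n in IH.
have cY : cone B Y by exact: sqrt_approx_cone.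
have cX : cone B X by exact: sqrt_approx_cone.
rewrite (_ : (fun x => _) = (fun x => (2^-1)%:C *: (Y (Y x - X x) + X (Y x - X x)))).
  apply: cone_scale; first by rewrite invr_ge0.
  exact: (cone_comp lB (cone_add cY cX) IH).
have lX : linear X by apply: cone_lin cX.
have lY : linear Y by apply: cone_lin cY.
have hXY x : X (Y x) = Y (X x).
  by apply: (cone_comm cY lX) => y; rewrite (cone_comm cX lB).
have EY x : Y x = (2^-1)%:C *: (B x + X (X x)) by [].
apply/funext => x; rewrite [X in _ - X]EY -scalerBr; congr (_ *: _).
rewrite (linearPB lY) (linearPB lX) hXY opprD addrACA subrr add0r.
by rewrite addrA subrK.
Qed.

Lemma sqrt_approx_le1 B n x : psd B -> (forall y, dot (B y) y <= dot y y) ->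
  dot (sqrt_approx B n x) x <= dot x x.
Proof.
move=> pB hB; elim: n x => [|n IH] x /=; first by rewrite dot0l dot_ge0.
have pY : psd (sqrt_approx B n) by apply: cone_psd (sqrt_approx_cone _ _) => //; exact: psd_lin.
rewrite dotZl dotDl (psd_sym pY).
have := psd_contraction x pY IH; have := IH x; have := hB x.
by lra.
Qed.

(** * Strong limits of increasing sequences of operators *)

Definition scvg (u : nat -> H) (l : H) :=
  ((fun n => dot (u n - l) (u n - l)) @ \oo --> (0 : R))%classic.

Lemma scvg_dot u l z : scvg u l -> ((fun n => dot (u n) z) @ \oo --> dot l z)%classic.
Proof.
move=> h; apply/cvgrPdist_lt => e e0.
(* With [t = e / K], both [t |z|^2] and [t^-1 |d|^2] are below [e] once [|d|^2 < e t], and [young]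
   bounds [2 |<d, z>|] by their sum. *)
pose K := dot z z + 1.
have K0 : 0 < K by have := dot_ge0 z; rewrite /K; lra.
have t0 : 0 < e / K by exact: divr_gt0.
have /cvgrPdist_lt/(_ _ (mulr_gt0 e0 t0)) := h; apply: filterS => n.
rewrite sub0r normrN ger0_norm ?dot_ge0 // (distrC (dot l z)) -dotNl -dotDl.
move: (u n - l) => d hd.
have hz : e / K * dot z z < e.
  by rewrite mulrAC -mulrA gtr_pMr // ltr_pdivrMr // mul1r /K; lra.
have hd' : (e / K)^-1 * dot d d < e by rewrite ltr_pdivrMl // mulrC.
have y1 := young z d t0; have y2 := young (- z) d t0.
rewrite !dotNl !dotNr opprK in y2; rewrite (dotC d z) ltr_norml.
by apply/andP; split; lra.
Qed.

Arguments scvg_dot {u l} z _.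

Lemma scvg_norm u l : scvg u l -> ((fun n => dot (u n) (u n)) @ \oo --> dot l l)%classic.
Proof.
move=> h; have hl := scvg_dot l h.
rewrite (_ : (fun n => _) = (fun n => dot (u n - l) (u n - l)
   + (dot (u n) l + dot (u n) l - dot l l))); last first.
  by apply/funext => n; rewrite !dotE (dotC l (u n)); ring.
have := cvgD h (cvgB (cvgD hl hl) (cvg_cst (dot l l))).
by rewrite add0r addrK; exact.
Qed.

Hypothesis hcomp : forall u, cauchy_seq ip u -> exists l, converges_to ip u l.

Lemma cauchy_scvg u :
  (forall e, 0 < e -> exists N, forall m n, (N <= m)%N -> (N <= n)%N ->
     dot (u m - u n) (u m - u n) < e) -> exists l, scvg u l.
Proof.
move=> h; have /hcomp[l hl] : cauchy_seq ip u.
  move=> [e1 e2]; rewrite ltcE /= => /andP[/eqP -> e0]; have [N hN] := h _ e0.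
  by exists N => m n hm hn; rewrite ip_dot ltcR hN.
exists l; apply/cvgrPdist_lt => e e0.
have [|N hN] := hl e%:C; first by rewrite ltcR.
exists N => // n /= hn; rewrite sub0r normrN ger0_norm ?dot_ge0 //.
by rewrite -ltcR -ip_dot hN.
Qed.

(** By [psd_contraction], [|(Y_m - Y_n) x|^2 <= <Y_m x, x> - <Y_n x, x>], and the bounded monotone
    sequence [<Y_n x, x>] is Cauchy. *)
Lemma psd_monotone_scvg (Y : nat -> H -> H) :
  (forall n, psd (Y n)) -> (forall n, psd (fun x => Y n.+1 x - Y n x)) ->
  (forall n x, dot (Y n x) x <= dot x x) ->
  exists L : H -> H, forall x, scvg (fun n => Y n x) (L x).
Proof.
move=> pY pD bY.
have pB m n : (n <= m)%N -> psd (fun x => Y m x - Y n x).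
  move=> /subnK <-; elim: (m - n)%N => [|k IH].
    by apply: psd_eq psd0 => x; rewrite add0n subrr.
  apply: psd_eq (psdD (pD (k + n)%N) IH) => x.
  by rewrite addSn addrA subrK.
suff h x : exists l, scvg (fun n => Y n x) l by have [L hL] := choice h; exists L.
pose a n := dot (Y n x) x.
have am : {homo a : n m / (n <= m)%N >-> n <= m}.
  by move=> n m nm; have := psd_ge0 x (pB _ _ nm); rewrite !dotE /a; lra.
have bnd m n : (n <= m)%N -> dot (Y m x - Y n x) (Y m x - Y n x) <= a m - a n.
  move=> nm; have := psd_contraction x (pB _ _ nm); rewrite !dotDl !dotNl => -> //.
  move=> y; have := bY m y; have := psd_ge0 y (pY n); rewrite !dotE; lra.
have /cvg_ex[l hl] : cvgn a.
  apply: nondecreasing_is_cvgn => //; exists (dot x x) => _ [n _ <-]; exact: bY.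
apply: cauchy_scvg => e e0.
have e2 : 0 < e / 2 by lra.
have /cvgrPdist_lt/(_ _ e2)[N _ hN] := hl.
exists N => m n; wlog nm : m n / (n <= m)%N => [hw hm hn|hm hn].
  case/orP: (leq_total n m) => nm; first exact: hw.
  by rewrite -opprB dotNl dotNr opprK; apply: hw.
have := hN m hm; have := hN n hn; rewrite /= !ltr_norml => /andP[? ?] /andP[? ?].
by have := bnd _ _ nm; lra.
Qed.

(** The adjoint carries [C] over to the test vector, so both sides are weak limits of the same
    sequence. *)
Lemma scvg_commute (Y : nat -> H -> H) (L C C' : H -> H) :
  (forall x, scvg (fun n => Y n x) (L x)) -> dot_adjoint C C' ->
  (forall n x, C (Y n x) = Y n (C x)) -> forall x, C (L x) = L (C x).
Proof.
move=> hL hC hY x; apply: dot_ext => z.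
apply: (@cvg_unique _ (@Rhausdorff R) (((fun n => dot (Y n (C x)) z) @ \oo)%classic));
  last exact: scvg_dot.
rewrite hC (_ : (fun n => _) = (fun n => dot (Y n x) (C' z))); first exact: scvg_dot.
by apply/funext => n; rewrite -hY hC.
Qed.

(** Viewing multiplication by [k] as an operator with an adjoint gives complex homogeneity of limits
    and projections. *)
Lemma dot_adjoint_scale (k : R[i]) :
  dot_adjoint (fun x => k *: x) (fun x => (Num.conj k) *: x).
Proof.
case: hip => _ hC _ _ x y; rewrite /dot (hC (Num.conj k *: y)) !ipZl (hC x y).
by case: k (ip x y) => [a b] [c d] /=; ring.
Qed.

(** For [B = 1 - A] the limit [L] of the approximants satisfies [L = (B + L^2) / 2], so
    [(1 - L)^2 = A]. Since [L] is a limit of polynomials in [A], it inherits commutation. *)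
Lemma psd_sqrt_le1 A : psd A -> (forall x, dot (A x) x <= dot x x) ->
  exists S : H -> H, [/\ psd S, forall x, S (S x) = A x &
    forall C C', linear C -> dot_adjoint C C' -> (forall x, C (A x) = A (C x)) ->
      forall x, C (S x) = S (C x)].
Proof.
move=> pA hA; pose B x := x - A x.
have pB : psd B.
  split=> [k x y|x y|x].
  - by rewrite /B (psd_lin pA) scalerBr opprD addrACA.
  - by rewrite /B !dotE (psd_sym pA).
  - by rewrite /B !dotE; have := hA x; lra.
have hB x : dot (B x) x <= dot x x.
  by rewrite /B !dotE; have := psd_ge0 x pA; lra.
have lB := psd_lin pB; pose Y := sqrt_approx B.
have cY n : cone B (Y n) by exact: sqrt_approx_cone.
have pY n : psd (Y n) by exact: cone_psd (cY n).
have bY n x : dot (Y n x) x <= dot x x by exact: sqrt_approx_le1.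
have [|L hL] := psd_monotone_scvg pY _ bY.
  by move=> n; apply: cone_psd (sqrt_approx_incr n lB).
have uniq := @cvg_unique _ (@Rhausdorff R).
have sL : dot_adjoint L L.
  move=> x y; apply: uniq (scvg_dot y (hL x)) _.
  rewrite (_ : (fun n => _) = (fun n => dot (Y n y) x)); last first.
    by apply/funext => n; rewrite (psd_sym (pY n)) dotC.
  by rewrite dotC; apply: scvg_dot.
have aL x y : L (x + y) = L x + L y.
  by apply: dot_ext => z; rewrite sL !dotDl !sL.
have lL : linear L.
  move=> k x y; rewrite aL; congr (_ + _).
  apply/esym/(scvg_commute hL (dot_adjoint_scale k)) => n z.
  by rewrite linearPZ //; exact: psd_lin.
have L1 x : dot (L x) x <= dot x x.
  have hx := scvg_dot x (hL x); rewrite -(cvg_lim (@Rhausdorff R) hx).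
  apply: limr_le; first by apply/cvg_ex; exists (dot (L x) x).
  by apply: nearW => n; exact: bY.
(* The fixed-point equation is passed to the limit only on the diagonal, where norm convergence
   suffices; [dot_sym_ext] then yields the operator identity. *)
have Leq x : dot (L x) x = 2^-1 * (dot (B x) x + dot (L x) (L x)).
  have e : (fun n => dot (Y n.+1 x) x)
         = (fun n => 2^-1 * (dot (B x) x + dot (Y n x) (Y n x))).
    apply/funext => n; rewrite -[Y n.+1 x]/((2^-1)%:C *: (B x + Y n (Y n x))).
    by rewrite dotZl dotDl (psd_sym (pY n) (Y n x)).
  have := scvg_dot x (hL x); rewrite -cvg_shiftS e => hx; apply: uniq hx _.
  exact: (cvgM (cvg_cst _) (cvgD (cvg_cst _) (scvg_norm (hL x)))).
pose S x := x - L x.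
have pS : psd S.
  split=> [k x y|x y|x].
  - by rewrite /S lL scalerBr opprD addrACA.
  - by rewrite /S !dotE sL.
  - by rewrite /S !dotE; have := L1 x; lra.
exists S; split=> //.
  apply: dot_sym_ext (psd_lin pA) _ (psd_sym pA) _.
  - by move=> k x y; rewrite !(psd_lin pS).
  - by move=> x y; rewrite !(psd_sym pS).
  - move=> x; rewrite (psd_sym pS) /S !dotE (dotC x (L x)) Leq /B !dotE.
    by lra.
move=> C C' lC hC hCA x; rewrite /S linearPB //; congr (_ - _).
apply: (scvg_commute hL hC) => n y; apply: (cone_comm (cY n) lC) => z.
by rewrite /B linearPB // hCA.
Qed.

Lemma psd_sqrt A c : psd A -> 0 < c -> (forall x, dot (A x) x <= c * dot x x) ->
  exists S : H -> H, [/\ psd S, forall x, S (S x) = A x &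
    forall C C', linear C -> dot_adjoint C C' -> (forall x, C (A x) = A (C x)) ->
      forall x, C (S x) = S (C x)].
Proof.
move=> pA c0 hA.
have ci0 : 0 <= c^-1 by rewrite invr_ge0 ltW.
have [|S [pS hS cS]] := psd_sqrt_le1 (psdZ ci0 pA).
  by move=> x; rewrite dotZl ler_pdivrMl.
exists (fun x => (Num.sqrt c)%:C *: S x); split.
- by apply: psdZ => //; exact: sqrtr_ge0.
- move=> x; rewrite (linearPZ (psd_lin pS)) scalerA hS scalerA -!rmorphM.
  by rewrite -expr2 sqr_sqrtr ?ltW // divff ?gt_eqF // scale1r.
- move=> C C' lC hC hCA x; rewrite linearPZ // (cS C C') // => y.
  by rewrite linearPZ // hCA.
Qed.

(** * Boundedness, and regularity as a polynomial identity *)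

Lemma dot_adjoint_ip A B : linear A -> dot_adjoint A B -> is_adjoint ip A B.
Proof.
move=> lA h x y; apply/eqP; rewrite eq_complex -/(dot (A x) y) -/(dot x (B y)) h eqxx /=.
by rewrite -eqr_opp -!dot_i -linearPZ // h.
Qed.

Lemma bounded_op_dot A : bounded_op ip A ->
  exists2 c, 0 < c & forall x, dot (A x) (A x) <= c * dot x x.
Proof.
case=> _ [[c d] [c0 hc]]; move: c0; rewrite lecE /= => /andP[/eqP d0 c0].
exists (c + 1); first by lra.
move=> x; have := hc x; rewrite !ip_dot d0 -[c +i* 0]/(c%:C) -rmorphM lecR.
by have := dot_ge0 x; lra.
Qed.

Lemma psd_positive_op A c : psd A -> 0 <= c ->
  (forall x, dot (A x) (A x) <= c * dot x x) -> positive_op ip A.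
Proof.
move=> pA c0 hc; split; last by move=> x; exact: psd_ip_ge0.
split; first exact: psd_lin.
exists c%:C; rewrite lecR c0; split=> // x.
by rewrite !ip_dot -rmorphM lecR.
Qed.

Lemma regularP A c T T' : psd A -> 0 < c -> (forall x, dot (A x) x <= c * dot x x) ->
  linear T -> dot_adjoint T T' ->
  regular ip A T <-> forall x, A (A (T x)) = A (T (A x)).
Proof.
move=> pA c0 hA lT hT; have [S [pS hS cS]] := psd_sqrt pA c0 hA.
split=> [reg x|h S' pS' hS' x].
  have hSp : positive_op ip S.
    apply: (psd_positive_op pS (ltW c0)) => y.
    by rewrite -(psd_sym pS) hS hA.
  have E := reg S hSp hS.
  have AS y : A (S y) = S (A y) by rewrite -!hS.
  by rewrite E AS E !hS.
have {}pS' := positive_op_psd pS'.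
(* Any competing root [S'] commutes with [A = S'^2], hence with [S], so uniqueness applies. *)
have ES : S' =1 S.
  apply: psd_sqrt_unique => // y; last by rewrite hS hS'.
  apply: (cS S' S') => [||z]; [exact: psd_lin|exact: psd_sym|].
  by rewrite -!hS'.
have ATS y : A (T (S y)) = S (A (T y)).
  apply: (cS (fun z => A (T z)) (fun z => T' (A z))) => [k u v|u v|u].
  - by rewrite lT (psd_lin pA).
  - by rewrite (psd_sym pA) hT.
  - by rewrite h.
(* The goal is [S d = 0] for [d] the difference of [T S x] and [S T x]; it follows from
   [S^2 d = A d = 0]. *)
rewrite !ES; apply/esym/eqP; rewrite -hS -subr_eq0 -(linearPB (psd_lin pS)); apply/eqP.
apply: (symmetric_sqr_kernel (psd_sym pS)); rewrite hS (linearPB (psd_lin pA)) ATS.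
by rewrite -!hS subrr.
Qed.

(** * Compressions to the closure of a range *)

Section RangeProjection.
Variables (E P : H -> H).
Hypothesis pE : psd E.
Hypothesis hP : is_orth_proj ip (closure_ip ip (range E)) P.
Local Notation M := (closure_ip ip (range E)).

Let lE := psd_lin pE.

Lemma closure_range w : M (E w).
Proof.
by move=> e e0; exists (E w); split; [exists w|rewrite subrr ip0l].
Qed.

Lemma closure_range_approx x e : M x -> 0 < e ->
  exists w, dot (x - E w) (x - E w) < e.
Proof.
move=> hx e0; have [|_ [[w ->] hw]] := hx e%:C; first by rewrite ltcR.
by exists w; rewrite -ltcR -ip_dot.
Qed.

(** Symmetry makes [z] orthogonal to every [E w]. If [r = <y, z>] were positive, [young] with
    [t = r / K] and [E w] close to [y] would give [2 r < 2 r]. *)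
Lemma closure_range_ortho y z : M y -> E z = 0 -> dot y z = 0.
Proof.
move=> hy; wlog suff le0 : z / E z = 0 -> dot y z <= 0.
  move=> hz; apply/eqP; rewrite eq_le le0 //= -oppr_le0 -dotNr le0 //.
  by rewrite linearPN // hz oppr0.
move=> hz; rewrite leNgt; apply/negP => r0; set r := dot y z in r0.
pose K := dot z z + 1.
have K0 : 0 < K by have := dot_ge0 z; rewrite /K; lra.
have t0 : 0 < r / K by exact: divr_gt0.
have [w hw] := closure_range_approx hy (mulr_gt0 r0 t0).
have hr : dot z (y - E w) = r.
  by rewrite dotC dotDl dotNl (psd_sym pE) hz dot0r subr0.
have := young z (y - E w) t0; rewrite hr.
have h1 : r / K * dot z z < r.
  by rewrite mulrAC -mulrA gtr_pMr // ltr_pdivrMr // mul1r /K; lra.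
have h2 : (r / K)^-1 * dot (y - E w) (y - E w) < r by rewrite ltr_pdivrMl // mulrC.
by lra.
Qed.

Lemma proj_in x : M (P x).
Proof. by have [] := hP x. Qed.

Lemma proj_ortho x y : M y -> dot (x - P x) y = 0.
Proof. by have [_ h] := hP x; move=> /h; rewrite /dot => ->. Qed.

Lemma range_op_proj x : E (P x) = E x.
Proof.
apply/esym/eqP; rewrite -subr_eq0 -linearPB //; apply/eqP/dot_ext => z.
by rewrite (psd_sym pE) dot0l; apply: proj_ortho; exact: closure_range.
Qed.

Lemma proj_id y : M y -> P y = y.
Proof.
move=> hy; apply/esym/eqP; rewrite -subr_eq0; apply/eqP/dot_eq0.
(* Only the left factor is expanded: [y] and [P y] lie in [M], while [y - P y] lies in the kernel of
   [E]. *)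
rewrite {2}[y - P y]lock dotDl dotNl -lock.
have hE : E (y - P y) = 0 by rewrite linearPB // range_op_proj subrr.
by rewrite !closure_range_ortho ?subrr //; exact: proj_in.
Qed.

Lemma proj_ker x : P x = 0 <-> E x = 0.
Proof.
split=> [h|h]; first by rewrite -range_op_proj h linearP0.
apply: dot_eq0; have := proj_ortho x (proj_in x); rewrite dotDl dotNl.
by rewrite dotC (closure_range_ortho (proj_in x) h); lra.
Qed.

Lemma proj_sym : dot_adjoint P P.
Proof.
move=> x y; have := proj_ortho x (proj_in y); have := proj_ortho y (proj_in x).
by rewrite !dotDl !dotNl (dotC y) (dotC (P y)); lra.
Qed.

(** The defect of linearity [d] is a combination of vectors of [M] and is killed by [E], hence
    orthogonal to itself. *)
Lemma proj_lin : linear P.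
Proof.
move=> k x y; apply/eqP; rewrite -subr_eq0; apply/eqP/dot_eq0; set d := _ - _.
have hd : E d = 0.
  by rewrite /d (linearPB lE) lE !range_op_proj lE subrr.
rewrite {1}/d dotDl dotNl dotDl (dot_adjoint_scale k).
rewrite !closure_range_ortho ?addr0 ?subrr //; try exact: proj_in.
by rewrite linearPZ // hd scaler0.
Qed.

Lemma proj_range_op x : P (E x) = E x.
Proof. by apply: proj_id; exact: closure_range. Qed.

Lemma closure_rangeE x : M x <-> P x = x.
Proof. by split=> [|<-]; [exact: proj_id|exact: proj_in]. Qed.

Lemma closure_range_form_ge0 Q x : linear Q -> dot_adjoint Q Q ->
  (forall y, dot (Q y) y <= dot y y) -> (forall w, 0 <= dot (Q (E w)) (E w)) ->
  M x -> 0 <= dot (Q x) x.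
Proof.
move=> lQ sQ Q1 QE hx; rewrite leNgt; apply/negP => f0.
set f := dot (Q x) x in f0; pose K := dot (Q x) (Q x) + 1.
have K0 : 0 < K by have := dot_ge0 (Q x); rewrite /K; lra.
(* With [d = x - E w], the form at [E w] is at most [f + t |Q x|^2 + (1 + t^-1) |d|^2]. The choice
   of [t] bounds the second term by [- f / 2], and the closeness of [E w] to [x] puts the third
   below [- f / 2]. *)
pose t := - f / (2 * K).
have t0 : 0 < t by rewrite divr_gt0 //; lra.
have s0 : 0 < 1 + t^-1 by have := t0; rewrite -invr_gt0; lra.
have e0 : 0 < - f / (2 * (1 + t^-1)) by rewrite divr_gt0 //; lra.
have [w] := closure_range_approx hx e0; rewrite ltr_pdivlMr; last by lra.
set d := x - E w => hd; have := QE w.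
have -> : E w = x - d by rewrite /d subKr.
move: d hd => d hd; rewrite linearPB // !dotE (sQ d x) (dotC d (Q x)).
have := Q1 d; have := young (- Q x) d t0; rewrite dotNl dotNl dotNr opprK.
have : t * dot (Q x) (Q x) <= - f / 2.
  have -> : - f / 2 = t * K by rewrite /t; field; rewrite gt_eqF.
  by rewrite ler_pM2l // /K; lra.
move: hd; rewrite -/f; move: (t^-1) (dot d d) (dot (Q x) d) (dot (Q d) d) => s u v q.
by move=> *; lra.
Qed.

End RangeProjection.

(** * The compression and its defect operator *)

Section Compression.
Variables (E P T Ts : H -> H).
Hypothesis pE : psd E.
Hypothesis hP : is_orth_proj ip (closure_ip ip (range E)) P.
Hypothesis lT : linear T.
Hypothesis hT : dot_adjoint T Ts.
Hypothesis kerT : forall x, E x = 0 -> E (T x) = 0.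
Local Notation M := (closure_ip ip (range E)).

Let lE := psd_lin pE.
Let lP := proj_lin pE hP.
Let sP := proj_sym hP.

(** The compression is extended to all of [H]. Since [T] preserves the kernel of [E], the extension
    vanishes there, and its adjoint [T^* P] takes values in [M]. *)
Definition compr x := P (T x).
Definition compr_adj x := Ts (P x).
Definition defect x := x - compr_adj (compr x).
Local Notation C := compr.
Local Notation Cs := compr_adj.
Local Notation Q := defect.

Lemma compr_lin : linear C.
Proof. by move=> k x y; rewrite /compr lT lP. Qed.

Lemma compr_adjointP : dot_adjoint C Cs.
Proof. by move=> x y; rewrite /compr sP hT. Qed.

Lemma compr_adj_lin : linear Cs.
Proof. exact: dot_adjoint_lin compr_lin compr_adjointP. Qed.

Lemma compr_proj x : C (P x) = C x.
Proof.
apply/eqP; rewrite -subr_eq0 -(linearPB compr_lin); apply/eqP/(proj_ker pE hP)/kerT.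
by rewrite (linearPB lE) (range_op_proj pE hP) subrr.
Qed.

Lemma proj_compr x : P (C x) = C x.
Proof. exact: (proj_id pE hP (proj_in hP (T x))). Qed.

Lemma proj_compr_adj x : P (Cs x) = Cs x.
Proof.
apply: dot_ext => z; have aC := dot_adjoint_flip compr_adjointP.
by rewrite sP !aC compr_proj.
Qed.

Lemma defect_lin : linear Q.
Proof.
by move=> k x y; rewrite /defect compr_lin compr_adj_lin scalerBr opprD addrACA.
Qed.

Lemma defect_sym : dot_adjoint Q Q.
Proof.
move=> x y; rewrite /defect dotDl dotDr dotNl dotNr.
by rewrite -[dot x (Cs _)]compr_adjointP (dot_adjoint_flip compr_adjointP).
Qed.

Lemma dot_defect x : dot (Q x) x = dot x x - dot (C x) (C x).
Proof. by rewrite /defect dotDl dotNl (dot_adjoint_flip compr_adjointP). Qed.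

(** Identifies the arbitrary adjoint on [M] quantified in [quasinormal_contraction_on] with
    [T^* P]. *)
Lemma compr_adj_unique D :
  (forall x, M x -> M (D x)) ->
  (forall x y, M x -> M y -> ip (C x) y = ip x (D y)) ->
  forall y, M y -> D y = Cs y.
Proof.
move=> hD aD y hy; apply/eqP; rewrite -subr_eq0; apply/eqP/dot_eq0; set d := _ - _.
have hd : M d.
  apply/(closure_rangeE pE hP).
  by rewrite (linearPB lP) proj_compr_adj (proj_id pE hP (hD y hy)).
rewrite {2}/d dotDr dotNr -compr_adjointP [dot _ (D y)]/dot -aD //.
by rewrite subrr.
Qed.

Hypothesis hreg : forall x, E (E (T x)) = E (T (E x)).

(** By regularity [E T x - T E x] lies in the kernel of [E], which is that of [P]; so
    [E T x = P E T x = P T E x]. *)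
Lemma range_op_compr x : E (C x) = C (E x).
Proof.
rewrite /compr (range_op_proj pE hP) -[LHS](proj_range_op pE hP).
apply/eqP; rewrite -subr_eq0 -(linearPB lP); apply/eqP/(proj_ker pE hP).
by rewrite (linearPB lE) hreg subrr.
Qed.

Lemma range_op_compr_adj x : E (Cs x) = Cs (E x).
Proof.
apply: dot_ext => z; have aC := dot_adjoint_flip compr_adjointP.
by rewrite (psd_sym pE) !aC -range_op_compr (psd_sym pE).
Qed.

Lemma range_op_defect x : E (Q x) = Q (E x).
Proof. by rewrite /defect (linearPB lE) range_op_compr_adj range_op_compr. Qed.

(** Since [Q] commutes with [S = E^(1/2)], [<Q E w, E w> = <E Q S w, S w> >= 0]; density of the
    range extends this to [M]. *)
Lemma defect_ge0 c x : 0 < c -> (forall y, dot (E y) y <= c * dot y y) ->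
  (forall y, 0 <= dot (E (Q y)) y) -> M x -> 0 <= dot (Q x) x.
Proof.
move=> c0 hc hQ; have [S [pS hS cS]] := psd_sqrt pE c0 hc.
apply: (closure_range_form_ge0 defect_lin defect_sym) => [y|w].
  by rewrite dot_defect gerBl dot_ge0.
have QS y : Q (S y) = S (Q y).
  by apply: (cS Q Q defect_lin defect_sym) => z; rewrite range_op_defect.
by rewrite -hS QS -(psd_sym pS) hS.
Qed.

End Compression.

(** * Completely hyperexpansive operators *)

Section CompletelyHyperexpansive.
Variables (T Ts : H -> H) (c : R).
Hypothesis lT : linear T.
Hypothesis hT : dot_adjoint T Ts.
Hypothesis c0 : 0 < c.
Hypothesis bT : forall x, dot (T x) (T x) <= c * dot x x.
Hypothesis hche : comp_hyperexpansive ip T Ts.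

Local Notation a := (A_op T Ts).

Let lTs : linear Ts. Proof. exact: dot_adjoint_lin lT hT. Qed.

(** Pascal's rule splits each coefficient of positive index into the two sums. *)
Lemma altsumS n x : altsum T Ts n.+1 x = altsum T Ts n x - Ts (altsum T Ts n (T x)).
Proof.
pose F j := iter j Ts (iter j T x).
have FS j : F j.+1 = Ts (iter j Ts (iter j T (T x))) by rewrite -iterS -iterSr.
rewrite /altsum [LHS]big_ord_recl.
rewrite (eq_bigr (fun i : 'I_n.+1 => ((-1) ^+ i.+1 * 'C(n, i.+1)%:R) *: F i.+1
    + ((-1) ^+ i.+1 * 'C(n, i)%:R) *: F i.+1)); last first.
  by move=> i _; rewrite lift0 binS natrD mulrDr scalerDl.
rewrite big_split /= addrA; congr (_ + _).
  rewrite -[in RHS](big_mkord xpredT (fun j => ((-1) ^+ j * 'C(n, j)%:R) *: F j)).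
  (* The first sum runs one index too far, but its last term carries ['C(n, n.+1) = 0]. *)
  transitivity (\sum_(0 <= j < n.+2) (((-1) ^+ j * 'C(n, j)%:R) *: F j)).
    by rewrite big_mkord big_ord_recl !bin0.
  by rewrite big_nat_recr //= bin_small // mulr0 scale0r addr0.
rewrite (big_morph Ts (linearPD lTs) (linearP0 lTs)) -sumrN.
by apply: eq_bigr => i _; rewrite linearPZ // -FS -scaleNr exprS mulN1r mulNr.
Qed.

Lemma A_opS n x : a n.+1 x = a n x - Ts (a n (T x)).
Proof. by rewrite /A_op altsumS (linearPN lTs) opprK opprB addrC. Qed.

Lemma A_op0 x : a 0 x = - x.
Proof. by rewrite /A_op /altsum big_ord1 bin0 mulr1 scale1r. Qed.

Lemma A_op_ge0 n x : (0 < n)%N -> 0 <= dot (a n x) x.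
Proof.
move=> n0; have := hche n0 x; rewrite lecE => /andP[_].
by rewrite /A_op dotNl /dot /= oppr_ge0.
Qed.

Lemma A_op_lin n : linear (a n).
Proof.
elim: n => [|n IH] k x y; first by rewrite !A_op0 opprD scalerN.
by rewrite !A_opS lT !IH lTs scalerBr opprD addrACA.
Qed.

Lemma A_op_sym n : dot_adjoint (a n) (a n).
Proof.
elim: n => [|n IH] x y; first by rewrite !A_op0 dotNl dotNr.
by rewrite !A_opS dotDl dotDr (dotNl (Ts _)) (dotNr _ (Ts _))
  (dot_adjoint_flip hT) -hT (IH x) (IH (T x)).
Qed.

Lemma A_op_psd n : (0 < n)%N -> psd (a n).
Proof.
move=> n0; split; [exact: A_op_lin|exact: A_op_sym|].
by move=> x; exact: A_op_ge0.
Qed.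

Lemma dot_A_opS n x : dot (a n.+1 x) x = dot (a n x) x - dot (a n (T x)) (T x).
Proof. by rewrite A_opS dotDl (dotNl (Ts _)) (dot_adjoint_flip hT). Qed.

(** The forms decrease in [n] from [A_1 = T^* T - 1] on, so one constant serves every [n]. *)
Lemma A_op_bound n x : (0 < n)%N -> dot (a n x) x <= c * dot x x.
Proof.
case: n => // n _; elim: n => [|n IH].
  rewrite dot_A_opS !A_op0 !dotNl; have := bT x; have := dot_ge0 x; lra.
by rewrite dot_A_opS; have := psd_ge0 (T x) (A_op_psd (ltn0Sn n)); lra.
Qed.

Lemma regular_A_op n : (0 < n)%N ->
  regular ip (a n) T <-> forall x, a n (a n (T x)) = a n (T (a n x)).
Proof. by move=> n0; apply: (regularP (A_op_psd n0) c0) lT hT => x; exact: A_op_bound. Qed.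

(** If [A_n x = 0], then [- <A_n T x, T x> = <A_(n+1) x, x> >= 0]. *)
Lemma A_op_kerT n x : (0 < n)%N -> a n x = 0 -> a n (T x) = 0.
Proof.
move=> n0 h; have pn := A_op_psd n0; apply: (psd_kernel pn).
have := psd_ge0 x (A_op_psd (ltn0Sn n)); rewrite dot_A_opS h dot0l.
by have := psd_ge0 (T x) pn; lra.
Qed.

Lemma A_op_kerS n x : (0 < n)%N -> a n x = 0 -> a n.+1 x = 0.
Proof. by move=> n0 h; rewrite A_opS h A_op_kerT // linearP0 // subrr. Qed.

(* On the [T]-invariant kernel of [a n.+2] the form of [a n.+1] is preserved by
   [T], hence the nonnegative form of [a n] decreases linearly along orbits. *)
Lemma A_op_kerP n x : (0 < n)%N -> a n.+2 x = 0 -> a n.+1 x = 0.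
Proof.
move=> n0 h; have pn := A_op_psd n0; have p1 := A_op_psd (ltn0Sn n).
apply: (psd_kernel p1); set d := dot _ _.
have hk k : a n.+2 (iter k T x) = 0 by elim: k => //= k IH; exact: A_op_kerT.
have hd k : dot (a n.+1 (iter k T x)) (iter k T x) = d.
  elim: k => //= k IH; have := dot_A_opS n.+1 (iter k T x).
  by rewrite hk dot0l IH; lra.
have he k : dot (a n (iter k T x)) (iter k T x) = dot (a n x) x - k%:R * d.
  elim: k => [|k IH] /=; first by rewrite mul0r subr0.
  have := dot_A_opS n (iter k T x); rewrite hd IH -natr1 mulrDl mul1r; lra.
have d0 : 0 <= d by exact: psd_ge0.
apply/eqP; rewrite eq_le d0 andbT leNgt; apply/negP => d1.
have e0 : 0 <= dot (a n x) x / d by rewrite divr_ge0 // psd_ge0.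
(* At this [k] the form [<A_n x, x> - k d] would be negative. *)
have := archi_boundP e0; set k := Num.bound _.
rewrite ltr_pdivrMr // => hlt.
by have := psd_ge0 (iter k T x) pn; rewrite he; lra.
Qed.

Lemma A_op_ker2 n x : (2 <= n)%N -> a 2 x = 0 <-> a n x = 0.
Proof.
case: n => [|[|n]] // _; elim: n => // n IH; rewrite IH.
by split; [exact: A_op_kerS|exact: A_op_kerP].
Qed.

(** * The compression to the closure of the range of [A_2] *)

Variable P : H -> H.
Hypothesis hP : is_orth_proj ip (closure_ip ip (range (a 2))) P.
Local Notation M := (closure_ip ip (range (a 2))).
Local Notation C := (compr P T).
Local Notation Cs := (compr_adj P Ts).
Local Notation Q := (defect P T Ts).

Let p2 : psd (a 2). Proof. exact: A_op_psd. Qed.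
Let l2 := psd_lin p2.
Let ker2T x : a 2 x = 0 -> a 2 (T x) = 0. Proof. exact: A_op_kerT. Qed.
Let aC := compr_adjointP hP hT.
Let lC := compr_lin p2 hP lT.
Let lQ := defect_lin p2 hP lT hT.

Let a2T x : a 2 (T x) = a 2 (C x).
Proof. by rewrite /compr (range_op_proj p2 hP). Qed.

(** Here [T^* A_2 T = T^* P A_2 C = C^* A_2 C = A_2 C^* C]. *)
Lemma A_op3_defect : (forall x, a 2 (a 2 (T x)) = a 2 (T (a 2 x))) ->
  forall x, a 3 x = a 2 (Q x).
Proof.
move=> h2 x; rewrite A_opS a2T -(proj_range_op p2 hP (C x)) -/(Cs _).
by rewrite /defect (linearPB l2) (range_op_compr_adj p2 hP hT h2).
Qed.

Lemma regular23_quasinormal :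
  (forall x, a 2 (a 2 (T x)) = a 2 (T (a 2 x))) ->
  (forall x, a 3 (a 3 (T x)) = a 3 (T (a 3 x))) ->
  forall x, C (Cs (C x)) = Cs (C (C x)).
Proof.
move=> h2 h3 x.
have h3Q := A_op3_defect h2.
have h2C := range_op_compr p2 hP h2.
have h2Q := range_op_defect p2 hP hT h2.
have h3T y : a 3 (T y) = a 3 (C y) by rewrite !h3Q !h2Q a2T.
pose z := Q (C x) - C (Q x).
have zE : z = C (Cs (C x)) - Cs (C (C x)).
  by rewrite /z /defect (linearPB lC) opprB addrC addrA subrK.
have : a 2 (a 2 (Q z)) = 0.
  rewrite /z (linearPB lQ (Q (C x))) (linearPB l2 (Q (Q (C x)))).
  rewrite (linearPB l2 (a 2 (Q (Q (C x))))).
  have := h3 x; rewrite !h3T !h3Q -!h2Q => ->.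
  by rewrite -h2C -h2Q subrr.
(* Now [A_3 z = A_2 Q z = 0], so [A_2 z = 0] by equality of kernels; since [z] lies in [M], it
   vanishes. *)
move=> /(symmetric_sqr_kernel (psd_sym p2)); rewrite -h3Q => h3z.
have /(proj_ker p2 hP) : a 2 z = 0 by apply/(@A_op_ker2 3).
rewrite zE (linearPB (proj_lin p2 hP)) (proj_compr _ p2 hP).
by rewrite (proj_compr_adj p2 hP lT hT ker2T) => /eqP; rewrite subr_eq0 => /eqP.
Qed.

(* By induction [a n.+2] is [Q ^ n (a 2)], and both factors commute with [C]. *)
Lemma quasinormal_regular :
  (forall x, a 2 (a 2 (T x)) = a 2 (T (a 2 x))) ->
  (forall x, C (Cs (C x)) = Cs (C (C x))) ->
  forall n x, a n.+2 (a n.+2 (T x)) = a n.+2 (T (a n.+2 x)).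
Proof.
move=> h2 hq n.
have QC x : Q (C x) = C (Q x) by rewrite /defect (linearPB lC) hq.
suff [hC hCT] : (forall x, a n.+2 (C x) = C (a n.+2 x)) /\
    (forall x, a n.+2 (T x) = a n.+2 (C x)).
  by move=> x; rewrite !hCT hC.
elim: n => [|n [hC hCT]]; first by split=> // x; rewrite (range_op_compr p2 hP h2).
(* Dual form of [A_(n+2) T = A_(n+2) C]: [T^*] and [C^*] agree on the range of [A_(n+2)]. *)
have hTs y : Ts (a n.+2 y) = Cs (a n.+2 y).
  apply: dot_ext => z; rewrite (dot_adjoint_flip hT) (dot_adjoint_flip aC).
  by rewrite !(@A_op_sym n.+2) hCT.
have hS x : a n.+3 x = Q (a n.+2 x) by rewrite A_opS hCT hTs hC.
by split=> x; rewrite !hS ?hCT // hC QC.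
Qed.

(** The identity on [M] extends to [H] through [C = C P]; the contraction bound is [Q >= 0] on [M],
    obtained from [A_2 Q = A_3 >= 0]. *)
Lemma quasinormal_contraction_comprP :
  (forall x, a 2 (a 2 (T x)) = a 2 (T (a 2 x))) ->
  quasinormal_contraction_on ip M (fun x => P (T x)) <->
  forall x, C (Cs (C x)) = Cs (C (C x)).
Proof.
move=> h2; have inM := closure_rangeE p2 hP.
split=> [[_ hq] x|hq].
  rewrite -(compr_proj p2 hP lT ker2T x).
  apply: (hq Cs) (proj_in hP x) => [y _|y z _ _].
    by apply/inM; rewrite (proj_compr_adj p2 hP lT hT ker2T).
  exact: (dot_adjoint_ip lC aC).
split=> [x hx|D hD aD x hx].
  rewrite !ip_dot lecR -subr_ge0 -(dot_defect hP hT).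
  apply: (defect_ge0 p2 hP lT hT h2 c0) hx => y; first exact: A_op_bound.
  by rewrite -A_op3_defect //; exact: A_op_ge0.
have DE := compr_adj_unique p2 hP lT hT ker2T hD aD.
rewrite (DE _ (proj_in hP (T x))) (DE _ (proj_in hP (T (P (T x))))).
exact: hq.
Qed.

End CompletelyHyperexpansive.
End RealInnerProduct.

Theorem theorem4p5 (R : realType) (H : lmodType R[i]) (ip : H -> H -> R[i])
  (hH : hilbert_space ip)
  (T Ts : H -> H) (hT : bounded_op ip T) (hTs : is_adjoint ip T Ts)
  (hDreg : regular ip (Delta T Ts) T)
  (hche : comp_hyperexpansive ip T Ts)
  (P : H -> H)
  (hP : is_orth_proj ip (closure_ip ip (range (A_op T Ts 2))) P) :
  let i_ := forall n : nat, (2 <= n)%N -> regular ip (A_op T Ts n) T in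
  let ii_ := regular ip (A_op T Ts 2) T /\ regular ip (A_op T Ts 3) T in
  let iii_ := regular ip (A_op T Ts 2) T /\
      quasinormal_contraction_on ip (closure_ip ip (range (A_op T Ts 2)))
        (fun x => P (T x)) in
  [/\ (i_ <-> ii_), (ii_ <-> iii_) &
      ((i_ \/ ii_ \/ iii_) ->
        forall n : nat, (3 <= n)%N ->
          forall x : H, A_op T Ts 2 x = 0 <-> A_op T Ts n x = 0)].
Proof.
case: hH => hip hcomp i_ ii_ iii_; have [c c0 bT] := bounded_op_dot hip hT.
have lT : linear T by case: hT.
have aT := is_adjoint_dot hTs.
have regP := regular_A_op hip hcomp lT aT c0 bT hche.
have i_ii : i_ -> ii_ by move=> h; split; apply: h.
have ii_iii : ii_ -> iii_.
  case=> r2 r3; have h2 := (regP 2 isT).1 r2; have h3 := (regP 3 isT).1 r3; split=> //.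
  apply/(quasinormal_contraction_comprP hip hcomp lT aT c0 bT hche hP h2).
  exact: (regular23_quasinormal hip lT aT hche hP h2 h3).
have iii_i : iii_ -> i_.
  case=> r2 q [|[|n]] // _; have h2 := (regP 2 isT).1 r2; apply/regP => //.
  apply: (quasinormal_regular hip lT aT hche hP h2).
  exact/(quasinormal_contraction_comprP hip hcomp lT aT c0 bT hche hP h2).
split; [by split; auto|by split; auto|].
by move=> _ n n3 x; apply: (A_op_ker2 hip lT aT hche) => //; exact: ltnW.
Qed.
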